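(* Let $c \in \mathbb{R}^n$, let $Q$ be a real symmetric $n \times n$ matrix, let $\sigma > 0$, and let $m(s) = c^T s + \frac12 s^T Q s + \frac13 \sigma \|s\|^3$ for $s \in \mathbb{R}^n$. Let $\bar s \in \mathbb{R}^n$ be a stationary point of $m$. Define a point $\hat s$ as follows: (a) if $c^T \bar s > 0$, then $\hat s := -\bar s$; (b) if $c^T \bar s \le 0$ and a vector $d \in \mathbb{R}^n$ exists such that $d^T (Q + \sigma \|\bar s\| I) d < 0$, then, for such a $d$: (i) if $\bar s = 0$, then $\hat s := \bar s + \alpha d$, with any $\alpha$ such that $$0 < \alpha < -\frac{3\, d^T Q d}{2\, \sigma \|d\|^3};$$ (ii) if $\bar s \neq 0$ and $\bar s^T d \neq 0$, then $$\hat s := \bar s - 2 \frac{\bar s^T d}{\|d\|^2} d;$$ (iii) if $\bar s \neq 0$ and $\bar s^T d = 0$, then $$\hat s := \bar s - 2 \frac{\bar s^T z}{\|z\|^2} z,$$ where $z := \bar s + \alpha d$ and $\alpha$ is any real number with $$\alpha > \frac{c^T d - \sqrt{(c^T d)^2 + (c^T \bar s)\,\bigl[d^T (Q + \sigma \|\bar s\| I) d\bigr]}}{d^T (Q + \sigma \|\bar s\| I) d}.$$ Then, in each of these cases, $m(\hat s) < m(\bar s)$.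
   Context: $\|\cdot\|$ is the Euclidean norm and $I$ is the $n \times n$ identity matrix. A point $s^* \in \mathbb{R}^n$ is called a stationary point of $m$ if $\nabla m(s^* ) = c + Q s^* + \sigma \|s^*\| s^* = 0$; equivalently, $c + Q s^* + \lambda s^* = 0$ with $\lambda = \sigma \|s^*\|$. *)

(* Defs.v *)
From HB Require Import structures.
From mathcomp Require Import all_boot all_order all_algebra.
From mathcomp Require Import all_classical all_reals all_analysis.
From mathcomp Require Import ring.

Set Implicit Arguments.
Unset Strict Implicit.
Unset Printing Implicit Defensive.

Import Order.TTheory GRing.Theory Num.Theory.
Import numFieldNormedType.Exports.

Local Open Scope classical_set_scope.
Local Open Scope ring_scope.

Definition dotp (R : realType) (n : nat) (u v : 'cV[R]_n) : R :=
  (u^T *m v) 0 0.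

(* The Euclidean norm; the library norm `|v| on matrices is the sup norm. *)
Definition enorm (R : realType) (n : nat) (v : 'cV[R]_n) : R :=
  Num.sqrt (dotp v v).

Definition cubic_model (R : realType) (n : nat) (c : 'cV[R]_n) (Q : 'M[R]_n)
    (sigma : R) (s : 'cV[R]_n) : R :=
  dotp c s + 2^-1 * dotp s (Q *m s) + 3^-1 * sigma * enorm s ^+ 3.

(* [derive] is total; for [cubic_model] every directional derivative exists,
   see [is_derive_cubic]. *)
Definition gradient (R : realType) (n : nat) (f : 'cV[R]_n -> R)
    (x : 'cV[R]_n) : 'cV[R]_n :=
  \col_i 'D_(delta_mx i 0) f x.

Definition stationary_point (R : realType) (n : nat) (f : 'cV[R]_n -> R)
    (x : 'cV[R]_n) : Prop :=
  gradient f x = 0.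

Section CubicModelGradient.
Variables (R : realType) (n : nat).
Implicit Types (u v w s c : 'cV[R]_n) (Q : 'M[R]_n) (a b t : R).

Lemma dotpE u v : dotp u v = \sum_i u i 0 * v i 0.
Proof. by rewrite /dotp mxE; apply: eq_bigr => i _; rewrite mxE. Qed.
Lemma dotpC u v : dotp u v = dotp v u.
Proof. by rewrite !dotpE; apply: eq_bigr => i _; rewrite mulrC. Qed.
Lemma dotpDr u v w : dotp u (v + w) = dotp u v + dotp u w.
Proof. by rewrite /dotp mulmxDr mxE. Qed.
Lemma dotpZr a u v : dotp u (a *: v) = a * dotp u v.
Proof. by rewrite /dotp -scalemxAr mxE. Qed.
Lemma dotpDl u v w : dotp (u + v) w = dotp u w + dotp v w.
Proof. by rewrite ![dotp _ w]dotpC dotpDr. Qed.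
Lemma dotpZl a u v : dotp (a *: u) v = a * dotp u v.
Proof. by rewrite ![dotp _ v]dotpC dotpZr. Qed.
Lemma dotp_ge0 u : 0 <= dotp u u.
Proof. by rewrite dotpE; apply: sumr_ge0 => i _; rewrite -expr2 sqr_ge0. Qed.
Lemma dotp_eq0 u : dotp u u = 0 -> u = 0.
Proof.
rewrite dotpE => /eqP; rewrite psumr_eq0; last by move=> i _; rewrite -expr2 sqr_ge0.
move=> /allP H; apply/colP => i; rewrite mxE.
by have := H i (mem_index_enum _); rewrite /= mulf_eq0 orbb => /eqP.
Qed.
Lemma dotp_sym Q u v : Q^T = Q -> dotp u (Q *m v) = dotp v (Q *m u).
Proof.
move=> HQ; rewrite [RHS]dotpC /dotp trmx_mul HQ mulmxA //.
Qed.

Lemma is_derive_line (f : 'cV[R]_n -> R) s v l :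
  is_derive (0 : R) (1 : R) (fun t : R => f (s + t *: v)) l -> is_derive s v f l.
Proof.
have E : (fun h : R => h^-1 *: ((f \o shift s) (h *: v) - f s)) =
  (fun h : R => h^-1 *: (((fun t : R => f (s + t *: v)) \o shift (0:R)) (h *: (1:R)) - (fun t : R => f (s + t *: v)) 0)).
  apply/funext => h /=.
  by rewrite scale0r addr0 addr0 (addrC (h *: v)) [h *: 1]mulr1.
case=> D V; split; first by rewrite /derivable E.
by rewrite -V /derive E.
Qed.

Lemma is_derive_cubic c Q sigma s v : Q^T = Q ->
  is_derive s v (cubic_model c Q sigma)
    (dotp (c + Q *m s + (sigma * enorm s) *: s) v).
Proof.
move=> HQ; apply: is_derive_line.
set a := dotp s s; set b := dotp s v; set e := dotp v v.
have nE t : enorm (s + t *: v) = Num.sqrt (a + 2 * b * t + e * t ^+ 2).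
  rewrite /enorm; congr Num.sqrt.
  by rewrite !(dotpDl, dotpDr, dotpZl, dotpZr) (dotpC v s) -/a -/b -/e; ring.
have -> : (fun t => cubic_model c Q sigma (s + t *: v)) =
  (fun t : R => (dotp c s + 2^-1 * dotp s (Q *m s)) +
     (dotp c v + dotp v (Q *m s)) * t + (2^-1 * dotp v (Q *m v)) * (t ^+ 2)
     + 3^-1 * sigma * Num.sqrt (a + 2 * b * t + e * t ^+ 2) ^+ 3).
  apply/funext => t; rewrite /cubic_model nE mulmxDr -scalemxAr.
  rewrite !(dotpDl, dotpDr, dotpZl, dotpZr) (dotp_sym _ _ HQ) (dotp_sym s v HQ).
  by field.
have HN : is_derive (0:R) (1:R) (fun t : R => Num.sqrt (a + 2 * b * t + e * t ^+ 2) ^+ 3) (3 * enorm s * b).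
  have [a0|a0] := eqVneq a 0.
    have s0 : s = 0 by apply: dotp_eq0.
    have -> : b = 0 by rewrite /b s0 -(scale0r (0 : 'cV[R]_n)) dotpZl mul0r.
    rewrite !mulr0.
    have -> : (fun t : R => Num.sqrt (a + 0 * t + e * t ^+ 2) ^+ 3) =
      (fun t : R => (Num.sqrt e ^+ 3 * `|t|) * t ^+ 2).
      apply/funext => t; rewrite a0 mul0r !add0r sqrtrM ?dotp_ge0 //.
      by rewrite sqrtr_sqr exprMn [`|t| ^+ 3]exprS real_normK ?num_real // mulrA.
    set k := Num.sqrt e ^+ 3.
    pose g := fun t : R => k * `|t| * t ^+ 2.
    have Hc : (fun h : R => h^-1 *: ((g \o shift (0 : R)) (h *: (1 : R)) - g 0)) @ 0^' --> (0 : R).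
      rewrite (_ : (fun h : R => _) = (fun h : R => k * `|h| * h)); last first.
        apply/funext => h; rewrite /g /= addr0 /GRing.scale /= mulr1 expr0n /= mulr0 subr0.
        have [->|h0] := eqVneq h 0; first by rewrite !(mulr0, expr0n, mul0r, normr0) /=.
        by field.
      apply: cvg_within_filter.
      have L : (fun h : R => k * `|h| * h) @ nbhs (0 : R) --> (k * `|0 : R| * 0 : R).
        apply: cvgM; last exact: cvg_id.
        apply: cvgM; [exact: cvg_cst|exact: norm_continuous].
      by rewrite mulr0 in L.
    by split; [apply/cvg_ex; exists 0; exact: Hc|apply: cvg_lim].
  have ap : 0 < a by rewrite lt_neqAle eq_sym a0 dotp_ge0.
  pose q := fun t : R => a + 2 * b * t + e * t ^+ 2.
  have q0 : q 0 = a by rewrite /q; ring.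
  have dq : is_derive (0:R) (1:R) q (2 * b).
    apply: is_derive_eq; rewrite /GRing.scale /=; ring.
  have ds : is_derive (q 0) (1:R) (@Num.sqrt R) (2 * Num.sqrt (q 0))^-1.
    by apply: is_derive1_sqrt; rewrite q0.
  have dc := @is_derive1_comp _ (@Num.sqrt R) q 0 _ _ ds dq.
  have dX := @is_deriveX _ _ _ 3 _ _ _ dc.
  have -> : (fun t : R => Num.sqrt (a + 2 * b * t + e * t ^+ 2) ^+ 3) = (Num.sqrt \o q) ^+ 3.
    by apply/funext => t; rewrite fctE.
  apply: (is_derive_eq dX).
  rewrite /GRing.scale /= q0 -/(enorm s).
  have : enorm s != 0 by rewrite /enorm sqrtr_eq0 -ltNge.
  by move=> ?; field.
apply: is_derive_eq.
rewrite !(dotpDl, dotpZl) -/b (dotpC (Q *m s)) /GRing.scale /=.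
by field.
Qed.

Lemma gradient_cubic_model c Q sigma s : Q^T = Q ->
  gradient (cubic_model c Q sigma) s = c + Q *m s + (sigma * enorm s) *: s.
Proof.
move=> HQ; apply/colP => i; rewrite mxE.
have D := is_derive_cubic c sigma s (delta_mx i 0) HQ.
rewrite derive_val dotpE (bigD1 i) //= [X in _ * X]mxE !eqxx mulr1 big1 ?addr0 //.
by move=> j ji; rewrite [X in _ * X]mxE (negbTE ji) mulr0.
Qed.
End CubicModelGradient.

(* Main.v *)
(** All points proposed after a direction of negative curvature at a nonzero
    stationary point are reflections of [sbar] through a hyperplane orthogonal
    to some [z].  They preserve the norm, so the change of the model is
    [k^2/2 * z^T H z], where [k] is the step along [z], and it suffices that
    [z] is not orthogonal to [sbar] and has negative curvature for [H].  When
    [d] is orthogonal to [sbar], [z = sbar + alpha d] has curvature a concave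
    quadratic in [alpha], negative beyond its larger root. *)
Require Import Defs.
From HB Require Import structures.
From mathcomp Require Import all_boot all_order all_algebra.
From mathcomp Require Import all_classical all_reals all_analysis.
From mathcomp Require Import ring lra.
Import Order.TTheory GRing.Theory Num.Theory.
Import numFieldNormedType.Exports.
Local Open Scope ring_scope.

Set Implicit Arguments.
Unset Strict Implicit.

Section Reflection.
Variables (R : realType) (n : nat).
Implicit Types (c d s u v z : 'cV[R]_n) (Q : 'M[R]_n) (a sigma : R).

Lemma sqr_enorm v : enorm v ^+ 2 = dotp v v.
Proof. by rewrite /enorm sqr_sqrtr // dotp_ge0. Qed.

Lemma enorm_gt0 v : v <> 0 -> 0 < enorm v.
Proof.
move=> v0; rewrite /enorm sqrtr_gt0 lt_neqAle dotp_ge0 andbT eq_sym.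
by apply/eqP => /dotp_eq0.
Qed.

Lemma dotp0l v : dotp 0 v = 0.
Proof. by rewrite -(scale0r (0 : 'cV[R]_n)) dotpZl mul0r. Qed.

Lemma dotp0r v : dotp v 0 = 0.
Proof. by rewrite dotpC dotp0l. Qed.

Lemma dotp_shift Q a u v :
  dotp u ((Q + a%:M) *m v) = dotp u (Q *m v) + a * dotp u v.
Proof. by rewrite mulmxDl mul_scalar_mx dotpDr dotpZr. Qed.

(** Stationarity reads [H s = - c], here paired with a test vector [v]; this is the form in which it
    is used from here on. *)
Lemma stationary_dotp c Q sigma s v : Q^T = Q ->
  stationary_point (cubic_model c Q sigma) s ->
  dotp v ((Q + (sigma * enorm s)%:M) *m s) = - dotp c v.
Proof.
move=> QT; rewrite /stationary_point gradient_cubic_model // => st.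
have := congr1 (dotp v) st; rewrite dotp0r !dotpDr dotpZr dotp_shift.
by rewrite (dotpC v c) => /eqP; rewrite -addrA addrC addr_eq0 => /eqP.
Qed.

(** Only the linear term is odd in [s]. *)
Lemma cubic_modelN c Q sigma s :
  cubic_model c Q sigma (- s) = cubic_model c Q sigma s - 2 * dotp c s.
Proof.
rewrite /cubic_model /enorm -scaleN1r -scalemxAr !(dotpZl, dotpZr).
by rewrite !mulN1r !opprK; ring.
Qed.

Lemma enorm_reflection s z : z <> 0 ->
  enorm (s - (2 * (dotp s z / enorm z ^+ 2)) *: z) = enorm s.
Proof.
move=> z0; rewrite sqr_enorm -scaleNr /enorm; congr Num.sqrt.
rewrite !(dotpDl, dotpDr, dotpZl, dotpZr) (dotpC z s).
have ? : dotp z z != 0 by apply/eqP => /dotp_eq0.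
by field.
Qed.

(* The cubic term depends only on the norm, so on a sphere the model is a
   quadratic with Hessian [H], whose first-order term at [s] vanishes. *)
Lemma cubic_model_same_norm c Q sigma s a z : Q^T = Q ->
  stationary_point (cubic_model c Q sigma) s ->
  enorm (s - a *: z) = enorm s ->
  cubic_model c Q sigma (s - a *: z) = cubic_model c Q sigma s
    + 2^-1 * a ^+ 2 * dotp z ((Q + (sigma * enorm s)%:M) *m z).
Proof.
move=> QT st nE; have sz := stationary_dotp z QT st.
have := congr1 (fun x => x ^+ 2) nE; rewrite !sqr_enorm.
move: sz; rewrite /cubic_model nE !dotp_shift -scaleNr mulmxDr -scalemxAr.
rewrite !(dotpDl, dotpDr, dotpZl, dotpZr) (dotp_sym s z QT) (dotpC z s).
set l := sigma * enorm s => sz nsz.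
have {}nsz : a ^+ 2 * dotp z z = 2 * a * dotp s z by lra.
have -> : dotp c z = - (dotp z (Q *m s) + l * dotp s z) by rewrite sz opprK.
rewrite [2^-1 * _ * (_ + _)]mulrDr.
(* Once stationarity has eliminated [c], a residue [l * a * dotp s z] remains; equality of norms
   identifies it with the part of the curvature of [H] due to the shift by [l]. *)
have -> : 2^-1 * a ^+ 2 * (l * dotp z z) = l * a * dotp s z.
  by transitivity (2^-1 * l * (a ^+ 2 * dotp z z)); [ring | rewrite nsz; field].
by field.
Qed.

Lemma cubic_model_reflection_lt c Q sigma s z : Q^T = Q ->
  stationary_point (cubic_model c Q sigma) s ->
  dotp s z <> 0 -> dotp z ((Q + (sigma * enorm s)%:M) *m z) < 0 ->
  cubic_model c Q sigma (s - (2 * (dotp s z / enorm z ^+ 2)) *: z)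
    < cubic_model c Q sigma s.
Proof.
move=> QT st /eqP sz zHz.
have z0 : z <> 0 by move=> z0; move: sz; rewrite z0 dotp0r eqxx.
rewrite (cubic_model_same_norm QT st (enorm_reflection s z0)).
rewrite gtrDl pmulr_rlt0 // mulr_gt0 ?invr_gt0 ?ltr0n // exprn_even_gt0 //=.
by rewrite !mulf_neq0 ?pnatr_eq0 ?invr_eq0 ?expf_neq0 // lt0r_neq0 ?enorm_gt0.
Qed.

End Reflection.

(** Multiplied by [D < 0], the quadratic becomes [(b - x * D) ^+ 2 - q ^+ 2], with [q] the square
    root. Beyond the larger root [b - x * D > q >= 0], so this product is positive. *)
Lemma concave_quadratic_lt0 (R : rcfType) (D b e x : R) :
  D < 0 -> e <= 0 -> (b - Num.sqrt (b ^+ 2 + e * D)) / D < x ->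
  D * x ^+ 2 - 2 * b * x - e < 0.
Proof.
move=> D0 e0; set q := Num.sqrt _.
have q2 : q ^+ 2 = b ^+ 2 + e * D.
  by rewrite sqr_sqrtr // addr_ge0 ?sqr_ge0 // mulr_le0 // ltW.
have q0 : 0 <= q by exact: sqrtr_ge0.
rewrite ltr_ndivrMr // => xlt.
have sq : q ^+ 2 < (b - x * D) ^+ 2.
  by rewrite ltr_pXn2r ?nnegrE //; lra.
rewrite -(nmulr_rgt0 _ D0); lra.
Qed.

Theorem theorem2 (R : realType) (n : nat) (c : 'cV[R]_n) (Q : 'M[R]_n)
    (sigma : R) (sbar : 'cV[R]_n) :
  Q^T = Q ->
  0 < sigma ->
  let m := cubic_model c Q sigma in
  stationary_point m sbar ->
  let H := Q + (sigma * enorm sbar)%:M in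
  (0 < dotp c sbar -> m (- sbar) < m sbar)
  /\
  (dotp c sbar <= 0 ->
   forall d : 'cV[R]_n, dotp d (H *m d) < 0 ->
     (sbar = 0 ->
      forall alpha : R,
        0 < alpha ->
        alpha < - (3 * dotp d (Q *m d) / (2 * sigma * enorm d ^+ 3)) ->
        m (sbar + alpha *: d) < m sbar)
     /\
     (sbar <> 0 -> dotp sbar d <> 0 ->
      m (sbar - (2 * (dotp sbar d / enorm d ^+ 2)) *: d) < m sbar)
     /\
     (sbar <> 0 -> dotp sbar d = 0 ->
      forall alpha : R,
        (dotp c d - Num.sqrt (dotp c d ^+ 2 + dotp c sbar * dotp d (H *m d)))
          / dotp d (H *m d) < alpha ->
        let z := sbar + alpha *: d in
        m (sbar - (2 * (dotp sbar z / enorm z ^+ 2)) *: z) < m sbar)).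
Proof.
move=> QT sigma0 m st H.
split=> [cs0|cs0 d dHd]; first by rewrite /m cubic_modelN; lra.
have d0 : d <> 0 by move=> d0; move: dHd; rewrite d0 dotp0l ltxx.
split; last split.
- move=> s0 alpha a0 alt.
  have c0 : c = 0.
    (* Testing stationarity at the origin against [c] itself gives [dotp c c = 0]. *)
    apply: dotp_eq0; apply: oppr_inj; rewrite -(stationary_dotp c QT st).
    by rewrite s0 mulmx0 dotp0r oppr0.
  have e0 : 0 < sigma * enorm d ^+ 3 by rewrite mulr_gt0 // exprn_gt0 // enorm_gt0.
  have ne : enorm (alpha *: d) = alpha * enorm d.
    rewrite /enorm dotpZl dotpZr mulrA -expr2 sqrtrM ?sqr_ge0 //.
    by rewrite sqrtr_sqr gtr0_norm.
  rewrite /m /cubic_model s0 c0 add0r ne !dotp0l /enorm dotp0l sqrtr0 -/(enorm d).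
  rewrite expr0n /= !mulr0 !addr0 -scalemxAr dotpZl dotpZr add0r.
  move: alt; rewrite -mulNr ltr_pdivlMr; last by lra.
  move=> alt; have a2 : 0 < alpha ^+ 2 by rewrite exprn_gt0.
  (* The model at [alpha *: d] is now [alpha ^+ 2 * k], and the upper bound on [alpha] says exactly
     that [k < 0]. *)
  set k := 2^-1 * dotp d (Q *m d) + 3^-1 * alpha * (sigma * enorm d ^+ 3).
  rewrite [ltLHS](_ : _ = alpha ^+ 2 * k); last by rewrite /k; field.
  by rewrite pmulr_rlt0 // /k; lra.
- by move=> _ sd; exact: cubic_model_reflection_lt.
- move=> s0 sd alpha alt /=; set z := sbar + alpha *: d; apply: cubic_model_reflection_lt => //.
    by rewrite /z dotpDr dotpZr sd mulr0 addr0 => /dotp_eq0.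
  (* By stationarity the mixed term [dotp sbar (H *m d)] is [- dotp c d] and the curvature at [sbar]
     is [- dotp c sbar]. *)
  have -> : dotp z (H *m z) =
      dotp d (H *m d) * alpha ^+ 2 - 2 * dotp c d * alpha - dotp c sbar.
    have HT : H^T = H by rewrite /H linearD /= QT tr_scalar_mx.
    rewrite /z mulmxDr -scalemxAr !(dotpDl, dotpDr, dotpZl, dotpZr).
    by rewrite (dotp_sym sbar d HT) !(stationary_dotp _ QT st); ring.
  exact: concave_quadratic_lt0.
Qed.
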